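(* Let $Q$ be a rooted tree network with root $O$ and total length $\mu$, and let $h$ be a hiding distribution on $Q$. If $h$ is balanced and $S$ is a depth-first search of $Q$, then the expected search time of $S$ is $$T(S,h)=\mu-\int_{x\in Q}\lambda(Q_x)\,dh(x).$$
   Context: $Q$ is a (finite) tree network with root node $O$: each arc $a$ is a segment of length $\lambda(a)>0$, and points of $Q$ may be nodes or interior points of arcs. $\lambda$ denotes the induced Lebesgue (length) measure on $Q$, $\mu=\lambda(Q)$, and $d$ is the path-length metric. Write $x\preceq y$ if $x$ lies on the path from $O$ to $y$, and $Q_x=\{y\in Q: x\preceq y\}$. The connected components of $Q_x\setminus\{x\}$ are the branches at $x$. The branch nodes are $O$ and all other nodes of degree at least 3. A hiding distribution $h$ is a Borel probability measure on $Q$. The search density of a region $R\subset Q$ with $\lambda(R)>0$ is $\rho(R)=h(R)/\lambda(R)$. $h$ is balanced if at every branch node all the branches have the same search density. A search is a function $S:[0,\infty)\to Q$ with $S(0)=O$ and $d(S(t_1),S(t_2))\le t_2-t_1$ for $0\le t_1<t_2$. Put $T(S,x)=\min\{t\ge 0:S(t)=x\}$ (or $+\infty$) and $T(S,h)=\int_Q T(S,x)\,dh(x)$. A depth-first (DF) search is a sequence of arcs traversed at unit speed, starting and ending at $O$, such that when leaving a node the unique arc towards the root is chosen only if all the other arcs at the node have been traversed; it traverses every arc exactly once in each direction, so $S(2\mu)=O$. *)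

(* Defs.v *)
From HB Require Import structures.
From mathcomp Require Import all_boot all_order all_algebra.
From mathcomp Require Import all_classical all_reals all_analysis.
Set Implicit Arguments.
Unset Strict Implicit.
Unset Printing Implicit Defensive.
Import Order.TTheory GRing.Theory Num.Theory.
Local Open Scope classical_set_scope.
Local Open Scope ring_scope.

(* A finite rooted tree with edge lengths.  The arcs are indexed by the
   non-root nodes: arc v joins tparent v (its upper end) to v (its lower end)
   and has length arc_len v.  The value arc_len troot has no meaning and is never used;
   tparent troot = troot is a convention, not an arc. *)
Record treeNetwork (R : realType) := TreeNetwork {
  tnode : finType;
  troot : tnode;
  tparent : tnode -> tnode;
  arc_len : tnode -> R;
  parent_root : tparent troot = troot;
  parent_conn : forall v, exists n, iter n tparent v = troot;
  len_gt0 : forall v, v != troot -> 0 < arc_len v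
}.

Section Points.
Context {R : realType} (Q : treeNetwork R).
Local Notation O := (troot Q).

(* Each point of the network has exactly one code: the root is (troot, 0), and
   any other point is (v, s) where s in ]0, arc_len v] is its distance from the
   upper end of arc v.  In particular a node v <> troot is (v, arc_len v). *)
Definition point_code (p : tnode Q * R) : bool :=
  if p.1 == O then p.2 == 0 else 0 < p.2 <= arc_len p.1.

Definition tpoint := {p : tnode Q * R | point_code p}.

HB.instance Definition _ := Choice.on tpoint.

Lemma node_code v : point_code (v, if v == O then 0 else arc_len v).
Proof.
by rewrite /point_code/=; case: eqVneq => //= v0; rewrite len_gt0 //= lexx.
Qed.

Definition node_point (v : tnode Q) : tpoint := Sub _ (node_code v).

Definition origin : tpoint := node_point O.

HB.instance Definition _ := isPointed.Build tpoint origin.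

(* The point of the closed arc v at distance s from its upper end, for
   s in [0, arc_len v]; the default value is only used at s = 0. *)
Definition arc_point (v : tnode Q) (s : R) : tpoint :=
  insubd (node_point (tparent v)) (v, s).

(* u lies on the path from the root to v (u = v allowed). *)
Definition anc : rel (tnode Q) := fun u v => fconnect (@tparent R Q) v u.

(* x lies on the path from the root to y. *)
Definition preceq (x y : tpoint) : bool :=
  if (val x).1 == (val y).1 then (val x).2 <= (val y).2
  else anc (val x).1 (val y).1.

Definition above (x : tpoint) : set tpoint := [set y | preceq x y].

(* Length of the part of arc v lying on the path from the root to x. *)
Definition path_cover (v : tnode Q) (x : tpoint) : R :=
  if v == (val x).1 then (val x).2
  else if anc v (val x).1 then arc_len v else 0.

(* The path from x to y consists of the points lying on exactly one of the
   paths from the root to x and to y, together with the point where these two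
   paths separate.  On arc v each of the two paths covers an initial segment,
   so the path from x to y has length |path_cover v x - path_cover v y| there. *)
Definition path_dist (x y : tpoint) : R :=
  \sum_(v | v != O) `|path_cover v x - path_cover v y|.

Lemma iter_parent_root n : iter n (@tparent R Q) O = O.
Proof. by elim: n => //= n ->; rewrite parent_root. Qed.

Lemma anc_root v : anc v O -> v = O.
Proof. by move=> /iter_findex <-; rewrite iter_parent_root. Qed.

Lemma anc_antisym u v : anc u v -> anc v u -> u = v.
Proof.
move=> uv vu.
have [k [uk k0]] : exists k, iter k (@tparent R Q) u = u /\ (0 < k \/ u = v)%N.
  have Ev := iter_findex vu; have Eu := iter_findex uv.
  exists (findex (@tparent R Q) v u + findex (@tparent R Q) u v)%N.
  rewrite iterD Ev Eu; split=> //.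
  case: (posnP (findex (@tparent R Q) v u)) => [f0|f0]; last first.
    by left; rewrite addn_gt0 f0.
  by right; rewrite -Eu f0.
case: k0 => // k0.
have [n un] := parent_conn u.
have itk m : iter (m * k) (@tparent R Q) u = u.
  by elim: m => // m IH; rewrite mulSn iterD IH.
have uO : u = O.
  rewrite -(itk n) -(subnK (leq_pmulr n k0)) iterD un.
  by rewrite iter_parent_root.
by rewrite uO in vu *; rewrite (anc_root vu).
Qed.

Lemma path_distxx x : path_dist x x = 0.
Proof. by rewrite /path_dist big1 // => v _; rewrite subrr normr0. Qed.

Lemma path_dist_sym x y : path_dist x y = path_dist y x.
Proof. by apply: eq_bigr => v _; rewrite distrC. Qed.

Lemma path_dist_triangle y x z :
  path_dist x z <= path_dist x y + path_dist y z.
Proof. by rewrite -big_split/= ler_sum // => v _; exact: ler_distD. Qed.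

Lemma path_dist_eq0 x y : path_dist x y = 0 -> x = y.
Proof.
move=> /eqP; rewrite psumr_eq0 // => /allP d0.
have cE v : v != O -> path_cover v x = path_cover v y.
  by move=> v0; have := d0 v (mem_index_enum _); rewrite v0 normr_eq0 subr_eq0
    => /eqP.
have key a b : (forall v, v != O -> path_cover v a = path_cover v b) ->
    (val a).1 != O -> anc (val a).1 (val b).1.
  move=> ab a0; have := ab _ a0; rewrite /path_cover eqxx.
  case: eqVneq => [-> _|_]; first exact: connect0.
  case: ifP => // _ a20; have := valP a.
  by rewrite /point_code (negbTE a0) a20 ltxx.
have E1 : (val x).1 = (val y).1.
  have [x0|x0] := eqVneq (val x).1 O.
    have [->//|y0] := eqVneq (val y).1 O.
    have := key y x (fun v v0 => esym (cE v v0)) y0.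
    by rewrite x0 => /anc_root yO; rewrite yO.
  have xy := key x y cE x0.
  have [y0|y0] := eqVneq (val y).1 O.
    by move: xy; rewrite y0 => /anc_root.
  exact: anc_antisym xy (key y x (fun v v0 => esym (cE v v0)) y0).
apply: val_inj; rewrite [val x]surjective_pairing [val y]surjective_pairing.
rewrite -E1; congr (_, _).
have [x0|x0] := eqVneq (val x).1 O.
  have := valP x; have := valP y; rewrite /point_code -E1 x0 eqxx.
  by move=> /eqP -> /eqP ->.
by have := cE _ x0; rewrite /path_cover -E1 eqxx.
Qed.

HB.instance Definition _ := isMetric.Build R tpoint
  path_distxx path_dist_eq0 path_dist_sym path_dist_triangle.

Definition borel_point := g_sigma_algebraType (@open tpoint).

(* Sum over the arcs of the Lebesgue measures of the traces of A. *)
Definition length_measure (A : set tpoint) : \bar R :=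
  (\sum_(v | v != O)
    lebesgue_measure [set s : R | exists2 x, A x & val x = (v, s)])%E.

Definition degree (v : tnode Q) : nat :=
  (#|[set c | (c != O) && (tparent c == v)]%SET| + (v != O))%N.

Definition branch_node (v : tnode Q) : Prop := v = O \/ (3 <= degree v)%N.

Definition branch (x : tpoint) (B : set tpoint) : Prop :=
  exists2 y, (above x `\ x) y & B = connected_component (above x `\ x) y.

Definition search_density (h : probability borel_point R) (B : set tpoint) : R :=
  fine (h B) / fine (length_measure B).

Definition balanced (h : probability borel_point R) : Prop :=
  forall v, branch_node v -> forall B1 B2 : set tpoint,
    branch (node_point v) B1 -> branch (node_point v) B2 ->
    search_density h B1 = search_density h B2.

(* Searches are functions on [0, +oo[; the values at negative times are
   ignored everywhere below. *)
Definition search (S : R -> tpoint) : Prop :=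
  S 0 = origin /\
  forall t1 t2, 0 <= t1 -> t1 < t2 -> mdist (S t1) (S t2) <= t2 - t1.

(* Since a search is continuous, the infimum is a minimum as soon as x is
   visited; otherwise it is +oo. *)
Definition search_time (S : R -> tpoint) (x : tpoint) : \bar R :=
  ereal_inf [set t%:E | t in [set t | 0 <= t /\ S t = x]].

Definition expected_search_time (S : R -> tpoint)
    (h : probability borel_point R) : \bar R :=
  (\int[h]_x search_time S x)%E.

(* (v, true) is the traversal of arc v away from the root, (v, false) the
   traversal of arc v towards the root. *)
Definition traversal : Type := tnode Q * bool.

Definition trav_source (a : traversal) := if a.2 then tparent a.1 else a.1.
Definition trav_target (a : traversal) := if a.2 then a.1 else tparent a.1.

Fixpoint walk (u : tnode Q) (w : seq traversal) (u' : tnode Q) : Prop :=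
  if w is a :: w' then
    [/\ a.1 != O, trav_source a = u & walk (trav_target a) w' u']
  else u = u'.

Definition df_sequence (w : seq traversal) : Prop :=
  [/\ walk O w O,
      forall w1 v w2, w = w1 ++ (v, false) :: w2 ->
        forall c, c != O -> tparent c = v -> exists b, (c, b) \in w1 &
      forall v b, v != O -> count_mem (v, b) w = 1%N].

Definition duration (w : seq traversal) : R := \sum_(a <- w) arc_len a.1.

Definition unit_speed_along (S : R -> tpoint) (w : seq traversal) : Prop :=
  forall w1 v b w2, w = w1 ++ (v, b) :: w2 ->
    forall s, 0 <= s <= arc_len v ->
      S (duration w1 + s) = arc_point v (if b then s else arc_len v - s).

(* The sequence of traversals takes up the time interval [0, 2 mu]; from then
   on the search is only required to be a search. *)
Definition depth_first (S : R -> tpoint) : Prop :=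
  search S /\ exists2 w, df_sequence w & unit_speed_along S w.

End Points.

(* Main.v *)
Require Import Defs.
From HB Require Import structures.
From mathcomp Require Import all_boot all_order all_algebra.
From mathcomp Require Import all_classical all_reals all_analysis.
From mathcomp Require Import measurable_realfun.
From mathcomp Require Import zify ring lra.
Local Open Scope classical_set_scope.
Local Open Scope ereal_scope.

Set Implicit Arguments.
Unset Strict Implicit.
Unset Printing Implicit Defensive.
Import Order.TTheory GRing.Theory Num.Theory numFieldNormedType.Exports.

(** Write L(a) for the total length of arc a and of everything below it, and
    T_a for the set of points of these arcs.  At depth s on arc v, a
    depth-first search arrives at time arrival v + s, while the length of the
    network from there on down is L(v) - s.  Thus T(S, x) + lambda(Q_x) is
    constant on each arc (search_time_df, length_above), and the theorem says
    that the mean of these constants under h is mu.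

    Counting what has been traversed when arc v is first entered gives
    arrival v + L(v) = mu + kappa(v), where kappa(v) sums the lengths of the
    arcs u incomparable with v, taken with sign + if u is traversed before v
    and with sign - otherwise (arrival_plus_subtree): the arcs above v have
    been traversed once, v and those below it not yet, and every other arc twice or
    not at all.  The paths from the root to u and to v separate at a unique
    pair of siblings b <= u and a <= v (separation_exists,
    separation_unique), and, since a depth-first search does not leave a
    subtree before exhausting it, u is visited before v if and only if b is
    visited before a (precedes_siblings).  Hence the mean of kappa is the sum,
    over ordered pairs of siblings (a, b), of sign(b, a) h(T_a) L(b).

    The sign is antisymmetric in (a, b).  Two siblings hang from a branch node,
    and T_a, T_b are two of its branches (branch_subtree), so that balance makes
    h(T_a) L(b) symmetric (balanced_siblings).  The sum therefore vanishes
    (balanced_sum_eq0). *)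

(** * Ancestors and siblings *)

Section TreeOrder.
Local Open Scope classical_set_scope.
Local Open Scope ring_scope.
Context {R : realType} {Q : treeNetwork R}.
Local Notation O := (troot Q).
Local Notation parent := (@tparent R Q).
Implicit Types u v a b : tnode Q.

Lemma anc_refl v : anc v v.
Proof. exact: connect0. Qed.

Lemma anc_trans v u w : anc u v -> anc v w -> anc u w.
Proof. by move=> uv vw; exact: connect_trans vw uv. Qed.

Lemma anc_iter n v : anc (iter n parent v) v.
Proof. exact: fconnect_iter. Qed.

Lemma anc_parent v : anc (parent v) v.
Proof. exact: fconnect1. Qed.

Lemma root_anc v : anc O v.
Proof. by have [n <-] := parent_conn v; exact: anc_iter. Qed.

Lemma ancP u v : anc u v -> exists n, iter n parent v = u.
Proof. by move=> /iter_findex <-; eexists. Qed.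

Lemma ancE u v : anc u v = (u == v) || anc u (parent v).
Proof.
apply/idP/orP => [|[/eqP->|]]; last 2 first.
- exact: anc_refl.
- by move=> /anc_trans; apply; exact: anc_parent.
move=> /ancP[[|n] <-]; first by left; rewrite /= eqxx.
by right; rewrite iterSr anc_iter.
Qed.

Lemma not_anc_parent v : v != O -> ~~ anc v (parent v).
Proof.
move=> vO; apply/negP => vp; have pv := anc_antisym vp (anc_parent v).
have [n] := parent_conn v; have -> : iter n parent v = v.
  by elim: n => //= n ->; rewrite -pv.
by move/eqP; rewrite (negbTE vO).
Qed.

Lemma anc_comparable a b v : anc a v -> anc b v -> anc a b || anc b a.
Proof.
move=> /ancP[m <-] /ancP[n <-].
by have [le|/ltnW le] := leqP m n; rewrite -(subnK le) iterD anc_iter ?orbT.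
Qed.

Lemma child_toward a v : anc a v -> a != v ->
  exists c, [/\ c != O, parent c = a & anc c v].
Proof.
move=> /ancP[n]; elim: n v => [v /= ->|n IH v]; first by rewrite eqxx.
rewrite iterSr => Ea av; have [ap|ap] := eqVneq a (parent v).
  exists v; split=> //; last exact: anc_refl.
  by apply: contra_neq av => vO; rewrite ap vO parent_root.
have [c [cO pc cp]] := IH _ Ea ap; exists c; split=> //.
exact: anc_trans cp (anc_parent v).
Qed.

Definition siblings a b : bool :=
  [&& a != O, b != O, parent a == parent b & a != b].

Lemma siblings_sym a b : siblings a b = siblings b a.
Proof.
by rewrite /siblings [parent a == _]eq_sym [a == b]eq_sym; case: (a != O);
  case: (b != O).
Qed.

Lemma siblings_not_anc a b : siblings a b -> ~~ anc a b.
Proof.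
case/and4P=> aO bO /eqP pab ab; rewrite ancE (negbTE ab)/= -pab.
exact: not_anc_parent.
Qed.

Definition incomparable u v : bool := ~~ anc u v && ~~ anc v u.

(** Climb from v towards the root: the last arc a on the way that is not an
    ancestor of u has a parent above u, and b is the child of this parent
    towards u. *)
Lemma separation_exists u v : incomparable u v ->
  exists a b, [/\ siblings a b, anc a v & anc b u].
Proof.
case/andP=> uv vu; have [n] := parent_conn v => nO.
have : anc (iter n parent v) u by rewrite nO root_anc.
elim: n {nO} => [|n IH]; first by rewrite /= (negbTE vu).
case: (boolP (anc (iter n parent v) u)) => [/IH//|au] pu.
set a := iter n parent v in au pu.
have [|b [bO pb bu]] := child_toward pu.
  by apply: contraNneq uv => <-; exact: (anc_iter n.+1).
exists a, b; split=> //; last exact: anc_iter.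
rewrite /siblings bO pb eqxx/= andbC; apply/andP; split.
  by apply: contraNneq au => ->.
by apply: contraNneq au => ->; exact: root_anc.
Qed.

Lemma siblings_disjoint a b v : siblings a b -> anc a v -> anc b v -> False.
Proof.
move=> sab av bv; have sba : siblings b a by rewrite siblings_sym.
by case/orP: (anc_comparable av bv); apply/negP; exact: siblings_not_anc.
Qed.

Lemma separation_incomparable u v a b :
  siblings a b -> anc a v -> anc b u -> incomparable u v.
Proof.
move=> sab av bu; apply/andP; split; apply/negP.
  by move=> uv; exact: siblings_disjoint sab av (anc_trans bu uv).
by move=> vu; exact: siblings_disjoint sab (anc_trans av vu) bu.
Qed.

(** Two candidates a and a' are both ancestors of v, hence comparable; were one
    strictly above the other, the upper one would also be above u, on the same
    path as its own sibling. *)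
Lemma separation_unique u v a b a' b' :
  siblings a b -> anc a v -> anc b u ->
  siblings a' b' -> anc a' v -> anc b' u -> a = a' /\ b = b'.
Proof.
have le c d c' d' : siblings c d -> anc d u -> siblings c' d' -> anc d' u ->
    anc c' c -> c' = c.
  move=> /and4P[_ _ /eqP pcd _] du s' d'u; rewrite ancE => /orP[/eqP//|].
  rewrite pcd => c'p; case: (@siblings_disjoint c' d' u) => //.
  by apply: anc_trans du; apply: anc_trans c'p (anc_parent d).
move=> sab av bu sab' av' bu'.
have aa' : a = a'.
  case/orP: (anc_comparable av av') => [/(le _ _ _ _ sab' bu' sab bu)//|].
  by move=> /(le _ _ _ _ sab bu sab' bu') ->.
split=> //; subst a'; case: (eqVneq b b') => // bb'.
case: (@siblings_disjoint b b' u) => //.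
move: sab sab' => /and4P[aO bO /eqP pab _] /and4P[_ b'O /eqP pab' _].
by rewrite /siblings bO b'O -pab -pab' eqxx bb'.
Qed.

End TreeOrder.

(** * Depth-first sequences of traversals *)

Section DepthFirstOrder.
Local Open Scope classical_set_scope.
Local Open Scope ring_scope.
Context {R : realType} {Q : treeNetwork R}.
Local Notation O := (troot Q).
Local Notation parent := (@tparent R Q).
Implicit Types (u v a b c : tnode Q) (w : seq (traversal Q)).

(** Crossing arc u is the only way to enter or to leave the subtree below it, and
    downward crossings exceed upward ones by 1, 0 or -1, according to
    which ends of the walk lie in that subtree. *)
Lemma walk_balance u w y x : u != O -> walk y w x ->
  (count_mem (u, true) w + anc u y = count_mem (u, false) w + anc u x)%N.
Proof.
move=> uO; elim: w y => [y /= ->//|[v d] w IH y] [/= vO src /IH {}IH].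
have nvp := not_anc_parent vO.
move: src IH; rewrite !xpair_eqE [v == u]eq_sym.
case: d => /= <-; rewrite /trav_source /trav_target/= [anc u v]ancE;
  case: eqVneq => [->|_] /=; rewrite ?(negbTE nvp); lia.
Qed.

Lemma walk_cat w1 w2 y x : walk y (w1 ++ w2) x ->
  exists2 z, walk y w1 z & walk z w2 x.
Proof.
elim: w1 y => [y|a w1 IH y] /=; first by exists y.
by case=> aO sa /IH[z wz zx]; exists z.
Qed.

Lemma walk_nonroot w y x (a : traversal Q) : walk y w x -> a \in w -> a.1 != O.
Proof.
elim: w y => //= e w IH y [eO _ wx]; rewrite inE => /orP[/eqP->//|].
exact: IH wx.
Qed.

Section Sequence.
Variable w : seq (traversal Q).
Hypothesis dfw : df_sequence w.

(** Each traversal occurs exactly once in a depth-first sequence, so that its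
    index is its rank in time. *)
Definition precedes (a b : traversal Q) := (index a w < index b w)%N.
Definition prefix_before (a : traversal Q) := take (index a w) w.

Lemma mem_df (a : traversal Q) : a.1 != O -> a \in w.
Proof.
case: a => v d /= vO; have [_ _ /(_ v d vO) c1] := dfw.
by rewrite -has_pred1 has_count c1.
Qed.

Lemma split_before (a : traversal Q) : a.1 != O ->
  w = prefix_before a ++ a :: drop (index a w).+1 w.
Proof.
move=> aO; have aw := mem_df aO.
by rewrite -{2}(nth_index a aw) -drop_nth ?index_mem// cat_take_drop.
Qed.

Lemma count_prefix (a : traversal Q) u d : u != O ->
  count_mem (u, d) (prefix_before a) = precedes (u, d) a.
Proof.
move=> uO; have [_ _ /(_ u d uO) c1] := dfw.
have : (count_mem (u, d) (prefix_before a) <= 1)%N.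
  by rewrite -c1; apply: leq_count_subseq; exact: take_subseq.
have <- : ((u, d) \in prefix_before a) = precedes (u, d) a.
  exact: in_take (mem_df _).
by rewrite -has_pred1 has_count; lia.
Qed.

Lemma precedes_trans b (a c : traversal Q) d :
  precedes a (b, d) -> precedes (b, d) c -> precedes a c.
Proof. exact: ltn_trans. Qed.

Lemma precedes_total u v d : u != O -> v != O -> u != v ->
  precedes (u, d) (v, d) = ~~ precedes (v, d) (u, d).
Proof.
move=> uO vO uv; rewrite /precedes -leqNgt ltn_neqAle.
case: eqVneq => //= /(congr1 (nth (u, d) w)).
by rewrite !nth_index ?mem_df// => -[/eqP]; rewrite (negbTE uv).
Qed.

(** The case of walk_balance in which the walk is stopped just before
    traversal a: the arcs crossed downwards only are those above the position
    reached. *)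
Lemma prefix_balance (a : traversal Q) u : a.1 != O -> u != O ->
  precedes (u, true) a = (precedes (u, false) a + anc u (trav_source a))%N :> nat.
Proof.
move=> aO uO; have [walkw _ _] := dfw.
move: walkw; rewrite {1}(split_before aO) => /walk_cat[z wz [_ za _]].
have := walk_balance uO wz; rewrite !count_prefix// za; case: (boolP (anc u O)).
  by move=> /anc_root uE; rewrite uE eqxx in uO.
by rewrite addn0.
Qed.

Lemma anc_precedes u v : u != O -> v != O -> anc u v -> u != v ->
  precedes (u, true) (v, true).
Proof.
move=> uO vO; rewrite ancE => /orP[/eqP->|up _]; first by rewrite eqxx.
have := @prefix_balance (v, true) u vO uO; rewrite /trav_source /= up.
by case: precedes => //; case: precedes.
Qed.

Lemma subtree_after_entry u v d : u != O -> v != O -> anc v u ->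
  ~~ precedes (u, d) (v, true).
Proof.
move=> uO vO vu; have npt : ~~ precedes (u, true) (v, true).
  have [->|uv] := eqVneq u v; first by rewrite /precedes ltnn.
  by rewrite precedes_total// negbK anc_precedes// eq_sym.
case: d => //; have := @prefix_balance (v, true) u vO uO.
by rewrite (negbTE npt); case: precedes.
Qed.

(** The depth-first rule speaks of the children of v only.  It extends to all
    descendants by descending the path from v to u: when the search is about to
    leave v, it is at v, hence outside the subtree of each child c, whose arc has
    been traversed; so c has been left, and the argument applies to c. *)
Lemma subtree_before_exit v u : v != O -> anc v u -> v != u ->
  precedes (u, false) (v, false).
Proof.
move=> vO /ancP[n]; elim: n v vO => [v _ /= ->|n IH v vO]; first by rewrite eqxx.
set c := iter n parent u => pc vu.
have cO : c != O by apply: contra_neq vO => cE; rewrite -pc /= -/c cE parent_root.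
have cv : precedes (c, false) (v, false).
  have [_ /(_ _ v _ (@split_before (v, false) vO) c cO pc)[d cd] _] := dfw.
  have := @prefix_balance (v, false) c vO cO; rewrite /trav_source/= -{3}pc.
  rewrite (negbTE (not_anc_parent cO)) addn0.
  have : precedes (c, d) (v, false) by rewrite /precedes -(in_take _ (mem_df _)).
  by case: d {cd} => ->; case: precedes.
case: (eqVneq c u) => [<-//|cu].
exact: precedes_trans (IH c cO erefl cu) cv.
Qed.

(** Seen from outside the subtree of p, all its arcs v are entered during one
    uninterrupted period that begins with the entry of p: to reach u after
    entering p the search must leave p, and it does so only when v is done. *)
Lemma subtree_contiguous p u v : p != O -> u != O -> v != O ->
  anc p v -> ~~ anc p u ->
  precedes (u, true) (v, true) = precedes (u, true) (p, true).
Proof.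
move=> pO uO vO pv pu; have [<-//|pNv] := eqVneq p v.
have p_v := anc_precedes pO vO pv pNv.
apply/idP/idP => [u_v|/precedes_trans]; last exact.
have up : u != p by apply: contraNneq pu => ->; exact: anc_refl.
rewrite precedes_total//; apply/negP => p_u.
(* At the start of u the position is outside the subtree of p, so p has been left. *)
have pf_u : precedes (p, false) (u, true).
  have := @prefix_balance (u, true) p uO pO; rewrite /trav_source/= p_u.
  case: (boolP (anc p (parent u))) => [ppu|_]; last by case: precedes.
  by rewrite (anc_trans ppu (anc_parent u)) in pu.
have vf_v : precedes (v, false) (v, true).
  apply: precedes_trans u_v; apply: precedes_trans pf_u.
  exact: subtree_before_exit.
have := @prefix_balance (v, true) v vO vO; rewrite vf_v {1}/precedes ltnn.
by [].
Qed.

(** subtree_contiguous replaces v by a, and then, the roles being exchanged, u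
    by b. *)
Lemma precedes_siblings u v a b : siblings a b -> anc a v -> anc b u ->
  precedes (u, true) (v, true) = precedes (b, true) (a, true).
Proof.
move=> sab av bu; have /and4P[aO bO _ ab] := sab.
have sba : siblings b a by rewrite siblings_sym.
have nonroot c d : c != O -> anc c d -> d != O.
  by move=> cO; apply: contraTneq => ->; apply: contra cO => /anc_root ->.
have [uO vO] : u != O /\ v != O by split; [exact: nonroot bu|exact: nonroot av].
have au : ~~ anc a u by apply/negP => /siblings_disjoint-/(_ b sab bu).
have ua : u != a by apply: contraNneq au => ->; exact: anc_refl.
rewrite (subtree_contiguous aO uO vO av au) (precedes_total true uO aO ua).
rewrite (subtree_contiguous bO aO uO bu) ?(siblings_not_anc sba)//.
by rewrite (precedes_total true bO aO)// eq_sym.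
Qed.

(** The search starts at the root, which is the lower end of no arc. *)
Definition arrival v : R :=
  if v == O then 0 else duration (prefix_before (v, true)).

Definition subtree_length v : R := \sum_(u | (u != O) && anc v u) arc_len u.

Definition visit_sign u v : R := if precedes (u, true) (v, true) then 1 else -1.

Lemma duration_prefix (a : traversal Q) :
  duration (prefix_before a) =
  \sum_(u | u != O) arc_len u *+ (precedes (u, true) a + precedes (u, false) a).
Proof.
rewrite /duration; set s := prefix_before a.
have -> : \sum_(e <- s) arc_len e.1 =
    \sum_(e : traversal Q) arc_len e.1 *+ count_mem e s.
  under [RHS]eq_bigr do rewrite -sum1_count -sumrMnr.
  rewrite (exchange_big_dep xpredT)//=; apply: eq_bigr => e _.
  by rewrite (big_pred1 e)// => i; rewrite /= eq_sym.
rewrite (eq_bigr (fun e => (fun u d => arc_len u *+ count_mem (u, d) s) e.1 e.2));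
  last by case.
rewrite -(pair_bigA _ (fun u d => arc_len u *+ count_mem (u, d) s))/=.
rewrite [RHS]big_mkcond; apply: eq_bigr => u _; rewrite big_bool/=.
case: ifPn => [uO|/negPn/eqP uO]; first by rewrite !count_prefix// mulrnDr.
have [walkw _ _] := dfw.
rewrite !(count_memPn _) ?addr0//; apply/negP => /mem_take/(walk_nonroot walkw);
  by rewrite uO eqxx.
Qed.

(** Compare arc by arc with the total length.  When arc v is about to be
    entered, an arc strictly above v has been traversed once; v and the arcs
    below it have not been traversed, but they are counted by subtree_length v;
    and an incomparable arc has been traversed twice or not at all, that is,
    1 + 1 or 1 - 1 times. *)
Lemma arrival_plus_subtree v :
  arrival v + subtree_length v = subtree_length O +
  \sum_(u | incomparable u v) arc_len u * visit_sign u v.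
Proof.
rewrite /arrival; case: eqVneq => [->|vO].
  rewrite add0r big1 ?addr0// => u; rewrite /incomparable => /andP[_].
  by rewrite root_anc.
rewrite duration_prefix /subtree_length.
rewrite (bigID (fun u => u != O) (incomparable^~ v)) /=.
rewrite [X in _ = _ + (_ + X)]big1 ?addr0; last first.
  by move=> u /andP[/andP[nuv _] /negPn/eqP uO]; rewrite uO root_anc in nuv.
rewrite [X in _ + X = _]big_mkcondr [X in _ = X + _]big_mkcondr/=.
under [X in _ = _ + X]eq_bigl do rewrite andbC.
rewrite [X in _ = _ + X]big_mkcondr -!big_split/=; apply: eq_bigr => u uO.
rewrite root_anc /incomparable /visit_sign.
have := @prefix_balance (v, true) u vO uO; rewrite /trav_source/=.
have [->|uv] := eqVneq u v.
  rewrite anc_refl /precedes ltnn/=.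
  by case: ltnP => // _ _; rewrite mulr0n add0r addr0.
have -> : anc u (parent v) = anc u v by rewrite [RHS]ancE (negbTE uv).
case: (boolP (anc u v)) => [auv|nuv].
  rewrite (anc_precedes uO vO auv uv).
  case: (boolP (anc v u)) => [avu|_]; first by rewrite (anc_antisym auv avu) eqxx in uv.
  by case: precedes => //= _; rewrite mulr1n.
case: (boolP (anc v u)) => [avu|nvu] /=.
  rewrite precedes_total// anc_precedes// 1?eq_sym//=.
  by case: precedes => // _; rewrite mulr0n add0r addr0.
by case: precedes; case: precedes => //= _; rewrite ?mulr2n ?mulr0n; lra.
Qed.

(** Sorted by the pair of siblings (a, b) at which u and v separate, the double
    sum becomes the sum of visit_sign b a times the mass below a times the
    length below b; the last two factors are jointly symmetric by hypothesis and
    the sign is antisymmetric, so exchanging a and b negates the sum. *)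
Lemma balanced_sum_eq0 (H : tnode Q -> R) :
  (forall a b, siblings a b ->
    (\sum_(v | anc a v) H v) * subtree_length b =
    (\sum_(v | anc b v) H v) * subtree_length a) ->
  \sum_v H v * (\sum_(u | incomparable u v) arc_len u * visit_sign u v) = 0.
Proof.
move=> bal; set HT := fun a => \sum_(v | anc a v) H v in bal.
pose X := \sum_(p : tnode Q * tnode Q | siblings p.1 p.2)
  visit_sign p.2 p.1 * (HT p.1 * subtree_length p.2).
have -> : \sum_v H v * (\sum_(u | incomparable u v) arc_len u * visit_sign u v)
    = X.
  (* For given u and v at most one pair p contributes, the one at which they
     separate. *)
  transitivity (\sum_v \sum_u \sum_(p : tnode Q * tnode Q | siblings p.1 p.2)
      (if anc p.1 v && ((u != O) && anc p.2 u) then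
       H v * (arc_len u * visit_sign p.2 p.1) else 0)).
    apply: eq_bigr => v _; rewrite mulr_sumr big_mkcond; apply: eq_bigr => u _.
    rewrite -big_mkcondr/=; case: ifPn => [inc|ninc].
      have [a [b [sab av bu]]] := separation_exists inc.
      rewrite (big_pred1 (a, b))/=.
        by rewrite /visit_sign (precedes_siblings sab av bu).
      move=> [a' b'] /=; rewrite xpair_eqE; apply/idP/andP.
        case/and4P => sab' av' _ bu'.
        by have [-> ->] := separation_unique sab' av' bu' sab av bu.
      case=> /eqP-> /eqP->; rewrite sab av bu !andbT/=.
      apply: contraTneq inc => ->; rewrite /incomparable.
      by rewrite root_anc.
    rewrite big1// => -[a b] /= /and4P[sab av _ bu].
    by rewrite (separation_incomparable sab av bu) in ninc.
  under eq_bigr do rewrite exchange_big/=.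
  rewrite exchange_big/=; apply: eq_bigr => -[a b] /= sab.
  rewrite /HT mulr_suml mulr_sumr [RHS]big_mkcond/=; apply: eq_bigr => v _.
  case: ifPn => av; last by rewrite big1// => u _; rewrite (negbTE av).
  rewrite /subtree_length !mulr_sumr [RHS]big_mkcond; apply: eq_bigr => u _/=.
  by case: ifP => // _; ring.
(* Exchange the two siblings. *)
suff : X = - X by lra.
rewrite {1}/X (reindex_inj (can_inj (fun p : tnode Q * tnode Q =>
  esym (surjective_pairing p) : (fun q => (q.2, q.1)) (p.2, p.1) = p)))/=.
rewrite -sumrN; apply: eq_big => [p|p]; first by rewrite siblings_sym.
move=> sp; rewrite bal// -mulNr; congr (_ * _).
have /and4P[aO bO _ ab] := sp.
rewrite /visit_sign (precedes_total true bO aO) 1?eq_sym//.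
by case: precedes => //=; rewrite ?opprK.
Qed.

End Sequence.
End DepthFirstOrder.

(** * Branches as connected components *)

Section Branches.
Local Open Scope classical_set_scope.
Local Open Scope ring_scope.
Context {R : realType} {Q : treeNetwork R}.
Local Notation O := (troot Q).
Local Notation parent := (@tparent R Q).
Implicit Types (u v a b c : tnode Q) (x y : tpoint Q).

Definition subtree c : set (tpoint Q) := [set y | anc c (val y).1].

Lemma tpoint_bounds x : (val x).1 != O -> 0 < (val x).2 <= arc_len (val x).1.
Proof. by move=> xO; have := valP x; rewrite /point_code (negbTE xO). Qed.

Lemma tpoint_root x : (val x).1 = O -> x = origin Q.
Proof.
move=> xO; apply: val_inj; have := valP x; rewrite /point_code xO eqxx => /eqP x0.
by rewrite [LHS]surjective_pairing xO x0 /= eqxx.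
Qed.

Lemma val_node_point v : val (node_point v) = (v, if v == O then 0 else arc_len v).
Proof. by []. Qed.

Lemma path_cover_gt0 c y : c != O -> (0 < path_cover c y) = anc c (val y).1.
Proof.
move=> cO; rewrite /path_cover; case: eqVneq => [cy|_].
  by rewrite cy anc_refl; rewrite cy in cO; have /andP[] := tpoint_bounds cO.
by case: ifP => _; rewrite ?len_gt0// ltxx.
Qed.

(** The quantity compared is one of the nonnegative terms of the distance. *)
Lemma path_cover_contraction c x y : c != O ->
  `|path_cover c x - path_cover c y| <= mdist x y.
Proof.
move=> cO; rewrite [leRHS](bigD1 c)//= lerDl.
by apply: sumr_ge0 => *; exact: normr_ge0.
Qed.

Lemma path_cover_continuous c : c != O ->
  continuous (path_cover c : tpoint Q -> R).
Proof.
move=> cO x; apply/(@cvgrPdist_lt _ _ _ (nbhs x)) => e e0.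
apply/nbhs_ballP; exists e => // y.
by rewrite ballEmdist; apply: le_lt_trans; exact: path_cover_contraction.
Qed.

Lemma subtreeE c : c != O -> subtree c = path_cover c @^-1` [set r | 0 < r].
Proof. by move=> cO; apply/seteqP; split=> y /=; rewrite path_cover_gt0. Qed.

Lemma open_subtree c : c != O -> open (subtree c).
Proof.
move=> cO; rewrite subtreeE//; apply: open_comp; last exact: open_gt.
by move=> x _; exact: path_cover_continuous.
Qed.

Lemma val_arc_point v s : v != O -> 0 < s <= arc_len v ->
  val (arc_point v s) = (v, s).
Proof.
by move=> vO s0; rewrite /arc_point val_insubd /point_code/= (negbTE vO) s0.
Qed.

Lemma arc_point0 v : v != O -> arc_point v 0 = node_point (parent v).
Proof.
move=> vO; apply: val_inj; rewrite /arc_point val_insubd /point_code/=.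
by rewrite (negbTE vO) ltxx.
Qed.

Lemma arc_point_end v : v != O -> arc_point v (arc_len v) = node_point v.
Proof.
move=> vO; apply: val_inj; rewrite val_arc_point ?len_gt0 ?lexx//.
by rewrite val_node_point (negbTE vO).
Qed.

Lemma arc_point_val x : (val x).1 != O -> arc_point (val x).1 (val x).2 = x.
Proof.
move=> xO; apply: val_inj; rewrite val_arc_point ?tpoint_bounds//.
by rewrite -surjective_pairing.
Qed.

(** One formula for the half-open arc and for its upper end, which is coded on
    another arc: this is what makes arc_point Lipschitz on the closed arc. *)
Lemma path_cover_arc_point w v s : w != O -> v != O -> 0 <= s <= arc_len v ->
  path_cover w (arc_point v s) =
  if w == v then s else if anc w v then arc_len w else 0.
Proof.
move=> wO vO /andP[]; rewrite le_eqVlt => /orP[/eqP <- _|s0 sv]; last first.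
  by rewrite /path_cover val_arc_point// s0.
rewrite arc_point0// /path_cover /=; have [->|wv] := eqVneq w v.
  rewrite (negbTE (not_anc_parent vO)); case: eqVneq => // vp.
  by have := not_anc_parent vO; rewrite -vp anc_refl.
rewrite [anc w v]ancE (negbTE wv)/=; case: eqVneq => [<-|//].
by rewrite (negbTE wO) anc_refl.
Qed.

Lemma arc_point_contraction v s t : v != O ->
  0 <= s <= arc_len v -> 0 <= t <= arc_len v ->
  mdist (arc_point v s) (arc_point v t) <= `|s - t|.
Proof.
move=> vO sv tv; rewrite [leLHS](bigD1 v)//= big1 ?addr0.
  by rewrite !path_cover_arc_point// eqxx.
by move=> w /andP[wO wv]; rewrite !path_cover_arc_point// (negbTE wv) subrr normr0.
Qed.

Lemma arc_segment_connected v s : v != O -> 0 <= s ->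
  connected (arc_point v @` `[s, arc_len v]).
Proof.
move=> vO s0; apply: connected_continuous_connected; first exact: segment_connected.
apply/subspace_continuousP => t /=; rewrite in_itv/= => /andP[st tv].
apply/cvg_ballP => e e0; rewrite near_withinE.
apply/nbhs_ballP; exists e => //= r tr; rewrite in_itv/= => /andP[sr rv].
rewrite ballEmdist/=; apply: le_lt_trans tr.
by apply: arc_point_contraction; rewrite ?tv ?rv ?(le_trans s0).
Qed.

(** A point is joined to the lower end of its own arc inside that arc, and the
    node so reached is joined to node a through the closed arcs on the path
    between them. *)
Lemma subtree_component a : a != O ->
  subtree a = connected_component (subtree a) (node_point a).
Proof.
move=> aO; apply/seteqP; split; last exact: connected_component_sub.
have nonroot u : anc a u -> u != O.
  by apply: contraTneq => ->; apply: contra aO => /anc_root ->.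
have node u : anc a u -> connected_component (subtree a) (node_point a) (node_point u).
  move=> /ancP[n]; elim: n u => [u /= ->|n IH u].
    by apply: connected_component_refl; exact: anc_refl.
  rewrite iterSr => Ea; have ap : anc a (parent u) by rewrite -Ea anc_iter.
  have uO : u != O by apply: contraTneq (nonroot _ ap) => ->; rewrite parent_root eqxx.
  apply: connected_component_trans (IH _ Ea) _.
  exists (arc_point u @` `[0, arc_len u]); first split.
  - by exists 0; rewrite ?arc_point0//= in_itv/= lexx ltW ?len_gt0.
  - move=> _ [s + <-]; rewrite /= in_itv/= => /andP[].
    rewrite le_eqVlt => /orP[/eqP<- _|s0 su]; first by rewrite arc_point0.
    rewrite /subtree/= val_arc_point ?s0//=; exact: anc_trans ap (anc_parent u).
  - exact: arc_segment_connected.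
  - by exists (arc_len u); rewrite ?arc_point_end//= in_itv/= lexx ltW ?len_gt0.
move=> y ay; apply: connected_component_trans (node _ ay) _.
have yO := nonroot _ ay; have /andP[y0 yl] := tpoint_bounds yO.
exists (arc_point (val y).1 @` `[(val y).2, arc_len (val y).1]); first split.
- by exists (arc_len (val y).1); rewrite ?arc_point_end//= in_itv/= lexx yl.
- move=> _ [s + <-]; rewrite /= in_itv/= => /andP[ys sl].
  by rewrite /subtree/= val_arc_point// (lt_le_trans y0 ys).
- by apply: arc_segment_connected => //; exact: ltW.
- by exists (val y).2; rewrite ?arc_point_val//= in_itv/= lexx.
Qed.

Lemma above_nodeE v : above (node_point v) `\ node_point v =
  \bigcup_(c in [set c | c != O /\ parent c = v]) subtree c.
Proof.
apply/seteqP; split=> [y [+ yv]|y [c [cO <-] cy]]; last first.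
  rewrite /above/= /preceq/=; have [E|_] := eqVneq (parent c) (val y).1.
    by move: cy (not_anc_parent cO); rewrite E /subtree/= => ->.
  split; first exact: anc_trans (anc_parent c) cy.
  by move=> Ey; move: cy (not_anc_parent cO); rewrite Ey /subtree/= => ->.
rewrite /above/= /preceq/=; have [E|vy] := eqVneq v (val y).1.
  rewrite E => le; case: yv; rewrite E.
  case: (eqVneq (val y).1 O) le => [yO _|yO le]; first by rewrite (tpoint_root yO).
  apply: val_inj; rewrite val_node_point (negbTE yO) [LHS]surjective_pairing.
  have /andP[_ ge] := tpoint_bounds yO.
  by congr (_, _); apply/eqP; rewrite eq_le ge le.
by move=> /child_toward-/(_ vy)[c [cO cp cy]]; exists c.
Qed.

(** The subtree of a is connected, and the points strictly below the node v
    are covered by the disjoint open sets subtree c, for c a child of v, so that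
    no connected set of such points can leave one of them. *)
Lemma branch_subtree a : a != O -> branch (node_point (parent a)) (subtree a).
Proof.
move=> aO; set v := parent a; set A := above (node_point v) `\ node_point v.
have aA : subtree a `<=` A by rewrite /A above_nodeE => y ay; exists a.
have aa : subtree a (node_point a) by exact: anc_refl.
exists (node_point a); first exact: aA.
apply/seteqP; split.
  apply: connected_component_max => //.
  by rewrite subtree_component//; exact: component_connected.
move=> y [C [Ca CA conC] Cy].
suff E : C `&` subtree a = C by move: Cy; rewrite -E => -[].
apply: conC; first by exists (node_point a).
  by exists (subtree a) => //; exact: open_subtree.
(* The complement of the other branches is closed. *)
exists (~` \bigcup_(c in [set c | siblings a c]) subtree c).
  apply: open_closedC; apply: bigcup_open => c /and4P[_ cO _ _].
  exact: open_subtree.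
apply/seteqP; split=> z [Cz].
  move=> az; split=> // -[c sac cz]; exact: siblings_disjoint sac az cz.
move=> nz; split=> //; move: (CA _ Cz); rewrite /A above_nodeE => -[c [cO cp] cz].
have [->//|ac] := eqVneq a c; case: nz; exists c => //=.
by rewrite /siblings aO cO cp ac eqxx.
Qed.

Lemma siblings_branch_node a b : siblings a b -> branch_node (parent a).
Proof.
case/and4P=> aO bO /eqP pab ab; have [->|pO] := eqVneq (parent a) O; first by left.
right; rewrite /degree pO addn1 ltnS.
rewrite -(_ : #|[set a; b]%SET| = 2%N); last by rewrite cards2 ab.
apply: subset_leq_card; apply/fintype.subsetP => c; rewrite !inE.
by case/orP => /eqP->; rewrite ?aO ?bO ?pab eqxx.
Qed.

End Branches.

(** * Lengths *)

Section Lengths.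
Local Open Scope classical_set_scope.
Local Open Scope ring_scope.
Context {R : realType} {Q : treeNetwork R}.
Local Notation O := (troot Q).
Implicit Types (u v a b : tnode Q) (x y : tpoint Q).

Lemma subtree_length_gt0 a : a != O -> 0 < subtree_length a.
Proof.
move=> aO; rewrite /subtree_length (bigD1 a) ?aO ?anc_refl//=.
rewrite ltr_wpDr ?len_gt0//; apply: sumr_ge0 => u /andP[/andP[uO _] _].
by rewrite ltW// len_gt0.
Qed.

(** Expresses the traces that define length_measure through arc_point, whose
    coordinates are known. *)
Lemma arc_trace (A : set (tpoint Q)) u : u != O ->
  [set s | exists2 x, A x & val x = (u, s)] =
  [set s | 0 < s <= arc_len u /\ A (arc_point u s)].
Proof.
move=> uO; apply/seteqP; split=> s.
  case=> x Ax xs; have xu : (val x).1 = u by rewrite xs.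
  have xE : arc_point u s = x by rewrite -[RHS]arc_point_val ?xu// xs.
  by rewrite /= xE; split=> //; have := tpoint_bounds (x := x); rewrite xs; exact.
by case=> s0 As; exists (arc_point u s); rewrite ?val_arc_point.
Qed.

Lemma length_measureE (A : set (tpoint Q)) (f : tnode Q -> R) :
  (forall u, u != O -> lebesgue_measure
     [set s | 0 < s <= arc_len u /\ A (arc_point u s)] = (f u)%:E) ->
  length_measure A = (\sum_(u | u != O) f u)%:E.
Proof.
by move=> Af; rewrite -sumEFin; apply: eq_bigr => u uO; rewrite arc_trace// Af.
Qed.

Lemma measure_arc_itv (l : R) : 0 < l ->
  lebesgue_measure [set s : R | 0 < s <= l] = l%:E.
Proof.
move=> l0; rewrite (_ : [set s | _] = [set` `]0, l]]).
  by rewrite lebesgue_measure_itv/= lte_fin l0 sube0.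
by apply/seteqP; split=> s; rewrite /= in_itv.
Qed.

Lemma length_subtree a : length_measure (subtree a) = (subtree_length a)%:E.
Proof.
rewrite (@length_measureE _ (fun u => if anc a u then arc_len u else 0)).
  by rewrite -big_mkcondr.
move=> u uO; case: ifPn => au.
  rewrite -[RHS]measure_arc_itv ?len_gt0//; congr (lebesgue_measure _).
  apply/seteqP; split=> s; first by case.
  by move=> s0; split=> //; rewrite /subtree/= val_arc_point.
rewrite (_ : [set s | _] = set0) ?measure0//.
apply/seteqP; split=> // s [s0]; rewrite /subtree/= val_arc_point//=.
by rewrite (negbTE au).
Qed.

Lemma length_above x :
  length_measure (above x) = (subtree_length (val x).1 - (val x).2)%:E.
Proof.
have [xO|xO] := eqVneq (val x).1 O.
  rewrite (tpoint_root xO) /= eqxx subr0 -length_subtree; congr length_measure.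
  apply/seteqP; split=> y _; rewrite /subtree/above/=; first exact: root_anc.
  rewrite /preceq /=; case: eqVneq => [yO|_]; last exact: root_anc.
  by rewrite (@tpoint_root _ _ y).
have /andP[x0 xl] := tpoint_bounds xO.
set v := (val x).1 in xO xl *; set r := (val x).2 in x0 xl *.
rewrite (@length_measureE _ (fun u => if u == v then arc_len v - r else
    if anc v u then arc_len u else 0)) => [|u uO].
  congr (_%:E); rewrite /subtree_length (bigD1 v)//= eqxx.
  rewrite [in RHS](bigD1 v) ?xO ?anc_refl//= [RHS]addrAC; congr (_ + _).
  rewrite big_mkcondr [RHS]big_mkcond/= [LHS]big_mkcond/=; apply: eq_bigr => u _.
  by case: (u != O); case: eqVneq => //=; case: anc.
have [->|uv] := eqVneq u v.
  rewrite (_ : [set s | _] = [set` `[r, arc_len v]]).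
    rewrite lebesgue_measure_itv/= lte_fin; case: ltP => // lr.
    have -> : r = arc_len v by apply/le_anti; rewrite lr xl.
    by rewrite subrr.
  apply/seteqP; split=> s; rewrite /= in_itv/= /above/= /preceq.
    by case=> s0; rewrite val_arc_point//= eqxx => ->; case/andP: s0.
  case/andP=> rs sl; have s0 : 0 < s <= arc_len v by rewrite (lt_le_trans x0 rs).
  by rewrite val_arc_point//= eqxx.
have E s : 0 < s <= arc_len u -> preceq x (arc_point u s) = anc v u.
  by move=> s0; rewrite /preceq val_arc_point//= eq_sym (negbTE uv).
case: ifPn => vu.
  rewrite -[RHS]measure_arc_itv ?len_gt0//; congr (lebesgue_measure _).
  apply/seteqP; split=> s; first by case.
  by move=> s0; split=> //; rewrite /above/= E.
rewrite (_ : [set s | _] = set0) ?measure0//.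
by apply/seteqP; split=> // s [s0]; rewrite /above/= E// (negbTE vu).
Qed.

Lemma subtree_root : subtree O = [set: tpoint Q].
Proof. by apply/seteqP; split=> // x _; exact: root_anc. Qed.

Lemma length_total :
  length_measure [set: tpoint Q] = (subtree_length O)%:E.
Proof. by rewrite -subtree_root length_subtree. Qed.

End Lengths.

(** * Search times *)

Section SearchTime.
Local Open Scope classical_set_scope.
Local Open Scope ring_scope.
Context {R : realType} {Q : treeNetwork R}.
Local Notation O := (troot Q).
Implicit Types (u v : tnode Q) (x : tpoint Q).

Lemma duration_ge0 (s : seq (traversal Q)) :
  {in s, forall e, e.1 != O} -> 0 <= duration s.
Proof.
move=> sO; rewrite /duration big_seq; apply: sumr_ge0 => e es.
by rewrite ltW// len_gt0// sO.
Qed.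

Lemma ongoing_traversal (s : seq (traversal Q)) t : 0 <= t < duration s ->
  exists s1 u d s2, s = s1 ++ (u, d) :: s2 /\
    0 <= t - duration s1 < arc_len u.
Proof.
elim: s t => [|[v e] s IH] t /andP[t0].
  by rewrite /duration big_nil ltNge t0.
rewrite /duration big_cons/= -/(duration s) => ts.
have [tv|vt] := ltP t (arc_len v).
  by exists [::], v, e, s; rewrite /duration big_nil subr0 t0.
have [|s1 [u [d [s2 [-> r]]]]] := IH (t - arc_len v).
  by rewrite subr_ge0 vt ltrBlDl.
exists ((v, e) :: s1), u, d, s2; split=> //.
by rewrite /duration big_cons/= opprD addrA.
Qed.

(** Let x lie on arc v.  This arc is first entered at time arrival v, and from
    then on x is approached at unit speed.  At an earlier time the search is on an arc that is not below v,
    and such an arc does not meet the subtree of v: there path_cover v is 0,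
    while it is positive at x. *)
Lemma search_time_df (S : R -> tpoint Q) w x :
  search S -> df_sequence w -> unit_speed_along S w ->
  search_time S x = (arrival w (val x).1 + (val x).2)%:E.
Proof.
move=> [S0 _] dfw Sw; rewrite /search_time.
set t0 := arrival w _ + _.
suff [t00 [St0 first]] : 0 <= t0 /\ S t0 = x /\
    forall t, 0 <= t -> S t = x -> t0 <= t.
  apply/le_anti/andP; split; first by apply: ereal_inf_lbound; exists t0.
  by apply/ereal_infP => _ [t [tge0 St] <-]; rewrite lee_fin first.
rewrite /t0 /arrival; case: eqVneq => [xO|vO].
  by rewrite (tpoint_root xO)/= eqxx addr0; do !split.
have /andP[x0 xl] := tpoint_bounds vO.
set v := (val x).1 in vO xl *; set r := (val x).2 in x0 xl *.
set s := prefix_before w (v, true).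
have [walkw _ _] := dfw.
have s_ge0 : 0 <= duration s.
  by apply: duration_ge0 => e /mem_take; exact: walk_nonroot walkw.
have Sarc q : 0 <= q <= arc_len v -> S (duration s + q) = arc_point v q.
  by move=> qv; rewrite (Sw _ _ _ _ (split_before dfw (a := (v, true)) vO)).
have coverx : path_cover v x = r by rewrite /path_cover eqxx.
split; first by rewrite addr_ge0// ltW.
split; first by rewrite Sarc ?arc_point_val// xl ltW.
move=> t t_ge0 Stx; rewrite leNgt; apply/negP => tlt.
have [st|ts] := leP (duration s) t.
  have qr : t - duration s < r by rewrite ltrBlDl.
  have q0 : 0 <= t - duration s <= arc_len v.
    by rewrite subr_ge0 st ltW// (lt_le_trans qr).
  have := Sarc _ q0; rewrite addrC subrK Stx => xE.
  move: coverx; rewrite xE path_cover_arc_point// eqxx => qE.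
  by rewrite qE ltxx in qr.
have [|s1 [u [d [s2 [sE /andP[q0 ql]]]]]] := @ongoing_traversal s t.
  by rewrite t_ge0 ts.
have uds : (u, d) \in s by rewrite sE mem_cat mem_head orbT.
have uO : u != O := walk_nonroot walkw (mem_take uds).
have wE : w = s1 ++ (u, d) :: (s2 ++ (v, true) :: drop (index (v, true) w).+1 w).
  by rewrite {1}(split_before dfw (a := (v, true)) vO) -/s sE -catA.
have := Sw _ _ _ _ wE (t - duration s1); rewrite q0 ltW//= addrC subrK.
move=> /(_ isT); rewrite Stx => xE.
have nvu : ~~ anc v u.
  apply/negP => vu; have := subtree_after_entry dfw d uO vO vu.
  by rewrite /precedes -in_take ?uds//; exact: (mem_df dfw (a := (u, d)) uO).
move: coverx; rewrite xE path_cover_arc_point//; last first.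
  by case: d {wE xE uds sE} => //; lra.
rewrite (negbTE nvu); case: eqVneq => [vu|_ r0]; last by rewrite -r0 ltxx in x0.
by rewrite vu anc_refl in nvu.
Qed.

End SearchTime.

(** * Masses and expectations *)

Section Expectation.
Local Open Scope classical_set_scope.
Local Open Scope ring_scope.
Context {R : realType} {Q : treeNetwork R}.
Local Notation O := (troot Q).
Implicit Types u v a b c : tnode Q.

Definition arc_fiber v : set (borel_point Q) := [set x | (val x).1 = v].

Lemma measurable_subtree c : measurable (subtree c : set (borel_point Q)).
Proof.
have [->|cO] := eqVneq c O; first by rewrite subtree_root; exact: measurableT.
by apply: sub_sigma_algebra; exact: open_subtree.
Qed.

(** The arcs need not be open or closed, but they are differences of open
    sets. *)
Lemma arc_fiberE v : arc_fiber v =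
  subtree v `\` \bigcup_(c in [set c | c != O /\ tparent c = v]) subtree c.
Proof.
apply/seteqP; split=> [x <-|x [vx nx]].
  split=> [|[c [cO cp]]]; first exact: anc_refl.
  by rewrite /subtree/= -cp; apply/negP; exact: not_anc_parent.
apply/eqP; rewrite eq_sym; apply: contraPT nx => nvx.
by have [c [cO cp cx]] := child_toward vx nvx; apply; exists c.
Qed.

Lemma measurable_arc_fiber v : measurable (arc_fiber v).
Proof.
rewrite arc_fiberE; apply: measurableD; first exact: measurable_subtree.
apply: fin_bigcup_measurable => [|c _]; first exact: finite_finset.
exact: measurable_subtree.
Qed.

Lemma measurable_node_fun (g : tnode Q -> R) :
  measurable_fun setT (fun x : borel_point Q => g (val x).1).
Proof.
move=> _ Y mY; rewrite setTI.
rewrite (_ : _ @^-1` Y = \bigcup_(v in [set v | Y (g v)]) arc_fiber v).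
  apply: fin_bigcup_measurable => [|v _]; first exact: finite_finset.
  exact: measurable_arc_fiber.
apply/seteqP; split=> [x Yx|x [v Yv xv]]; first by exists (val x).1.
by rewrite /preimage/= xv.
Qed.

Lemma measurable_path_cover v : v != O ->
  measurable_fun setT (path_cover v : borel_point Q -> R).
Proof.
move=> vO; apply: (measurability _ (RGenOpens.measurableE R)).
move=> _ [_ [a [b ->]] <-]; rewrite setTI; apply: sub_sigma_algebra.
apply: open_comp; last exact: interval_open.
by move=> x _; exact: path_cover_continuous.
Qed.

(** The depth may jump at a node, but on arc v it is the continuous function
    path_cover v. *)
Lemma measurable_depth : measurable_fun setT (fun x : borel_point Q => (val x).2).
Proof.
rewrite (_ : (fun _ => _) = fun x : borel_point Q => \sum_v
    ((v == (val x).1) && (v != O))%:R * path_cover v x).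
  apply: measurable_sum => v; have [->|vO] := eqVneq v O.
    by under eq_fun do rewrite andbF mul0r; exact: measurable_cst.
  apply: measurable_funM; last exact: measurable_path_cover.
  exact: (measurable_node_fun (fun u => ((v == u) && true)%:R)).
apply/funext => x; have [xO|xO] := eqVneq (val x).1 O.
  rewrite (tpoint_root xO)/= eqxx big1// => v _.
  by case: eqVneq; rewrite ?mul0r.
rewrite (bigD1 (val x).1)//= eqxx xO mul1r /path_cover eqxx big1 ?addr0// => v.
by move=> /negbTE->; rewrite mul0r.
Qed.

Variable h : probability (borel_point Q) R.

Definition arc_mass v : R := fine (h (arc_fiber v)).

Lemma expected_node_fun (g : tnode Q -> R) : (forall v, 0 <= g v) ->
  (\int[h]_x (g (val x).1)%:E)%E = (\sum_v g v * arc_mass v)%:E.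
Proof.
move=> g0; pose f v (x : borel_point Q) := ((g v)%:E * (\1_(arc_fiber v) x)%:E)%E.
transitivity (\int[h]_x \sum_v f v x)%E.
  apply: eq_integral => x _; rewrite (bigD1 (val x).1)//= big1.
    by rewrite /f indicE mem_set// mule1 adde0.
  move=> v vx; rewrite /f indicE memNset ?mule0//.
  by move=> xv; move: vx; rewrite -xv eqxx.
have m1 v : measurable_fun setT (fun x : borel_point Q => (\1_(arc_fiber v) x : R)%:E).
  by apply/measurable_EFinP; apply: measurable_indic; exact: measurable_arc_fiber.
rewrite ge0_integral_sum//; first last.
- by move=> v x _; rewrite /f mule_ge0 ?lee_fin.
- by move=> v; apply: measurable_funeM.
rewrite -sumEFin; apply: eq_bigr => v _.
rewrite ge0_integralZl_EFin//.
rewrite integral_indic ?setIT//; last exact: measurable_arc_fiber.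
by rewrite EFinM /arc_mass fineK// fin_num_measure//; exact: measurable_arc_fiber.
Qed.

Lemma mass_subtree a : h (subtree a) = (\sum_(v | anc a v) arc_mass v)%:E.
Proof.
have mA := measurable_subtree a.
rewrite -[in LHS](setIT (subtree a)) -integral_indic//.
transitivity (\int[h]_x ((anc a (val x).1)%:R : R)%:E)%E.
  apply: eq_integral => x _; rewrite indicE; congr ((nat_of_bool _)%:R%:E).
  by apply/idP/idP => [/set_mem//|ax]; rewrite mem_set.
rewrite (expected_node_fun (g := fun u => (anc a u)%:R))//; congr (_%:E); rewrite [RHS]big_mkcond.
by apply: eq_bigr => v _; case: anc; rewrite ?mul1r ?mul0r.
Qed.

(** The subtrees of a and b are two branches at the common parent, which is
    a branch node because it has two children. *)
Lemma balanced_siblings a b : balanced h -> siblings a b ->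
  (\sum_(v | anc a v) arc_mass v) * subtree_length b =
  (\sum_(v | anc b v) arc_mass v) * subtree_length a.
Proof.
move=> bal sab; have /and4P[aO bO /eqP pab _] := sab.
have := bal _ (siblings_branch_node sab) _ _ (branch_subtree aO).
rewrite {1}pab => /(_ _ (branch_subtree bO)).
rewrite /search_density !length_subtree !mass_subtree /=.
have La := subtree_length_gt0 aO; have Lb := subtree_length_gt0 bO.
by move/eqP; rewrite eqr_div ?lt0r_neq0// => /eqP ->.
Qed.

End Expectation.

(** * The expected search time *)

Theorem theorem3 (R : realType) (Q : treeNetwork R)
    (h : probability (borel_point Q) R) (S : R -> tpoint Q) :
  balanced h -> depth_first S ->
  expected_search_time S h =
    length_measure [set: tpoint Q] - \int[h]_x length_measure (above x).
Proof.
move=> bal [searchS [w dfw Sw]].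
pose T (x : borel_point Q) := (arrival w (val x).1 + (val x).2)%R.
pose L (x : borel_point Q) := (subtree_length (val x).1 - (val x).2)%R.
have ET : expected_search_time S h = \int[h]_x (T x)%:E.
  by apply: eq_integral => x _; exact: search_time_df.
have EL : \int[h]_x length_measure (above x) = \int[h]_x (L x)%:E.
  by apply: eq_integral => x _; exact: length_above.
have T0 x : 0 <= (T x)%:E.
  rewrite -(search_time_df x searchS dfw Sw).
  by apply/ereal_infP => _ [t [t0 _] <-]; rewrite lee_fin.
have L0 x : 0 <= (L x)%:E.
  rewrite -(length_above x).
  by apply: sume_ge0 => v _; exact: measure_ge0.
have mT : measurable_fun setT (EFin \o T).
  apply/measurable_EFinP; apply: measurable_funD; last exact: measurable_depth.
  exact: measurable_node_fun.
have mL : measurable_fun setT (EFin \o L).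
  apply/measurable_EFinP; apply: measurable_funB; last exact: measurable_depth.
  exact: measurable_node_fun.
pose kappa v := (\sum_(u | incomparable u v) arc_len u * visit_sign w u v)%R.
have sumE : \int[h]_x (T x)%:E + \int[h]_x (L x)%:E =
    (subtree_length (troot Q))%:E.
  rewrite -ge0_integralD//.
  pose g v := (arrival w v + subtree_length v)%R.
  transitivity (\int[h]_x (g (val x).1)%:E).
    by apply: eq_integral => x _; rewrite -EFinD /T /L /g; congr (_%:E); ring.
  rewrite expected_node_fun; last first.
    move=> v; have := adde_ge0 (T0 (node_point v)) (L0 (node_point v)).
    by rewrite -EFinD lee_fin /T /L /g /= addrACA subrr addr0.
  congr (_%:E).
  transitivity (\sum_v (subtree_length (troot Q) * arc_mass h v +
      arc_mass h v * kappa v))%R.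
    apply: eq_bigr => v _; rewrite /g (arrival_plus_subtree dfw) -/(kappa v).
    by rewrite mulrDl [(kappa v * _)%R]mulrC.
  rewrite big_split/= [X in (_ + X)%R](balanced_sum_eq0 dfw); last first.
    by move=> a b sab; exact: balanced_siblings.
  (* The masses of the arcs and of the root add up to 1. *)
  rewrite addr0 -mulr_sumr; apply: EFin_inj; rewrite EFinM.
  have := mass_subtree h (troot Q); rewrite subtree_root probability_setT.
  rewrite (eq_bigl xpredT) => [<-|v]; last exact: root_anc.
  by rewrite mule1.
rewrite ET EL length_total -sumE.
have : \int[h]_x (T x)%:E + \int[h]_x (L x)%:E \is a fin_num by rewrite sumE.
by rewrite fin_numD => /andP[_ Lfin]; rewrite addeK.
Qed.
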